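(* Let $f: \Omega_{\kappa,n} \to \mathbb{R}$ be an arbitrary function and let $(c_i)_{i=1,\ldots,n}$ be such that $|f(\omega) - f(\omega_{i^c}, \omega_i')| \le c_i$ for all $i$, all $\omega \in \Omega_{\kappa,n}$ and all admissible $\omega_i' \in \mathcal{X}$. Then for any $t \ge 0$, $$\mathbb{P}_{\kappa,n}\Big(\frac{1}{n!} \sum_{\sigma \in S_n} f(\sigma \omega) - \mathbb{E}_{\kappa,n} f \ge t \Big) \le \exp\Big( - \frac{t^2}{4(1-\frac{n}{N}) \sum_{i = 1}^n c_i^2} \Big).$$ In particular, if $f$ is symmetric (i.e. $f(\sigma\omega) = f(\omega)$ for all $\sigma \in S_n$) and satisfies $|f(\omega) - f(\omega_1', \omega_2, \ldots, \omega_n)| \le c$ for some $c > 0$ and all $\omega \in \Omega_{\kappa,n}$ and admissible $\omega_1'$, then for any $t \ge 0$, $$\mathbb{P}_{\kappa,n}\big( f - \mathbb{E}_{\kappa,n} f \ge t \big) \le \exp\Big( - \frac{t^2}{4\big( 1 - \frac{n}{N} \big) c^2 n} \Big).$$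
   Context: Let $L \ge 2$ be an integer, $\kappa = (\kappa_1,\ldots,\kappa_L)$ a vector of positive integers, $N = \kappa_1 + \cdots + \kappa_L$, and $\mathcal{X} = \{x_1,\ldots,x_L\} \subset \mathbb{R}$ a set of $L$ distinct reals. The multislice is $\Omega_\kappa = \{\omega \in \mathcal{X}^N : \#\{i : \omega_i = x_\ell\} = \kappa_\ell \text{ for } \ell = 1,\ldots,L\}$, with uniform distribution $\mathbb{P}_\kappa$. Sampling without replacement: for $1 \le n \le N$ let $pr_n$ be the projection onto the first $n$ coordinates, $\Omega_{\kappa,n} := pr_n(\Omega_\kappa)$, and let $\mathbb{P}_{\kappa,n}$ be the push-forward of $\mathbb{P}_\kappa$ under $pr_n$, with expectation $\mathbb{E}_{\kappa,n}$. $(\omega_{i^c},\omega_i')$ denotes the vector which agrees with $\omega$ in all coordinates but the $i$-th, where $\omega_i$ is replaced by $\omega_i'$; $\omega_i' \in \mathcal{X}$ is admissible if $(\omega_{i^c},\omega_i') \in \Omega_{\kappa,n}$. The symmetric group $S_n$ acts on $\Omega_{\kappa,n}$ by permuting the indices of $\omega$. If a denominator vanishes (e.g. $n = N$), the right-hand side is read as $0$ for $t > 0$ and as $1$ for $t = 0$. *)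

(* Defs.v *)
From HB Require Import structures.
From mathcomp Require Import all_boot all_order all_fingroup all_algebra.
From mathcomp Require Import reals sequences exp.

Set Implicit Arguments.
Unset Strict Implicit.
Unset Printing Implicit Defensive.

Import Order.TTheory GRing.Theory Num.Theory.
Local Open Scope ring_scope.

Definition slice_size (L : nat) (kappa : 'I_L -> nat) : nat :=
  (\sum_(l < L) kappa l)%N.

(* X^m for the set X = {x_1, ..., x_L} of reals: [seq_sub x] is the finite type
   of the members of x, which embeds in R through [val]. *)
Definition word (R : realType) (L : nat) (x : L.-tuple R) (m : nat) :=
  {ffun 'I_m -> seq_sub x}.

Section Multislice.
Variables (R : realType) (L : nat) (kappa : 'I_L -> nat) (x : L.-tuple R).

Definition multislice : {set word x (slice_size kappa)} :=
  [set w : word x (slice_size kappa) |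
    [forall l : 'I_L, #|[set i | val (w i) == tnth x l]| == kappa l]].

Definition multislice_prob (A : {set word x (slice_size kappa)}) : R :=
  #|A :&: multislice|%:R / #|multislice|%:R.

Variables (n : nat) (le_nN : (n <= slice_size kappa)%N).

Definition first_coords (w : word x (slice_size kappa)) : word x n :=
  [ffun i => w (widen_ord le_nN i)].

Definition sample : {set word x n} := first_coords @: multislice.

Definition sample_prob (A : {set word x n}) : R :=
  multislice_prob (first_coords @^-1: A).

Definition sample_expect (f : word x n -> R) : R :=
  \sum_(w in sample) f w * sample_prob [set w].

End Multislice.

Definition replace (R : realType) (L : nat) (x : L.-tuple R) (n : nat)
    (w : word x n) (i : 'I_n) (y : seq_sub x) : word x n :=
  [ffun j => if j == i then y else w j].

(* In MathComp (s * t) i = t (s i), so this is a left action of 'S_n. *)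
Definition permute (R : realType) (L : nat) (x : L.-tuple R) (n : nat)
    (s : 'S_n) (w : word x n) : word x n :=
  [ffun i => w (s i)].

Definition symmetrize (R : realType) (L : nat) (x : L.-tuple R) (n : nat)
    (f : word x n -> R) (w : word x n) : R :=
  (n`!%:R)^-1 * \sum_(s : 'S_n) f (permute s w).

(* exp (- t^2 / d) for t >= 0, with the value at d = 0 fixed to its limit as
   d decreases to 0 (MathComp's t^2 / 0 = 0 would give 1 for every t). *)
Definition gauss_bound (R : realType) (t d : R) : R :=
  if d == 0 then (t == 0)%:R else expR (- (t ^+ 2 / d)).

(* Main.v *)
Require Import Defs.
From HB Require Import structures.
From mathcomp Require Import classical_sets filter topology normedtype.
From mathcomp Require Import all_boot all_order all_fingroup all_algebra.
From mathcomp Require Import reals sequences exp.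
From mathcomp Require Import lra ring zify.

(** A function of the sample that is invariant under permuting the coordinates
    depends only on the set of sampled positions, or equivalently on the set
    [U] of the [u = N - n] positions left out.  The uniform law on the
    multislice is carried by a uniform random permutation of one fixed word,
    so [U] is a uniform random [u]-subset of the [N] positions
    ([mean_first_draws]), and swapping a point of [U] with a point outside it
    amounts to replacing one coordinate of the sample ([read_positions_lip]).

    It remains to bound the Laplace transform of a function [F] of a uniform
    [u]-subset [U] of a set [B] of size [m], when a swap changes [F] by at most
    [c].  Draw a uniform point [a] of [B] and then a uniform [u]-subset of
    [B :\ a]: the result is again a uniform [u]-subset of [B].  By swapping [a]
    and [b], the conditional means of [F] given [a] and [b] differ by at most
    [c * u / (m - 1)], where [u / (m - 1)] is the chance that [b] belongs to a
    [u]-subset of [B :\ a].  Each such step thus contributes to the exponent at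
    most half the square of this number, by the symmetrization
    argument of [mean_expR_sub_mean_le].  Since
      [u^2 / (2 (m-1)^2) <= u^2 / (m (m-1)) = u^2 / (m-1) - u^2 / m],
    the sum over the sizes [u + 1, ..., N] telescopes and is at most [c^2] times
    [u - u^2 / N = n (1 - n / N)] ([mean_draws_expR_le]).  Markov's inequality
    then gives the Gaussian tail, with the degenerate denominator treated as
    the limit of the exponential bounds ([le_gauss_bound]).

    For an arbitrary [f], symmetrizing keeps the expectation, and the
    symmetrized function changes by at most the average [cbar] of the [c i]
    when one coordinate is replaced; [n * cbar ^+ 2] is at most the sum of the
    [c i ^+ 2] by Cauchy-Schwarz. *)

Set Implicit Arguments.
Unset Strict Implicit.
Unset Printing Implicit Defensive.

Import Order.TTheory GRing.Theory Num.Theory numFieldNormedType.Exports.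
Local Open Scope ring_scope.

(** * Exponential inequalities *)

Lemma fact_double_ge m : (2 ^ m * m`! <= (m.*2)`!)%N.
Proof.
elim: m => [//|m IHm]; rewrite doubleS !factS expnS.
have -> : (2 * 2 ^ m * (m.+1 * m`!) = m.*2.+2 * (2 ^ m * m`!))%N by lia.
by rewrite leq_mul2l (leq_trans IHm) ?leq_pmull ?orbT.
Qed.

(** This is [cosh x <= exp (x^2 / 2)], by comparing the two power series term
    by term: the odd terms on the left cancel, and [(2m)! >= 2^m m!]. *)
Lemma expRDexpRN_le (R : realType) (x : R) :
  expR x + expR (- x) <= 2 * expR (x ^+ 2 / 2).
Proof.
have partial m : series (exp_coeff x) m.*2 + series (exp_coeff (- x)) m.*2
    <= 2 * series (exp_coeff (x ^+ 2 / 2)) m.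
  elim: m => [|m IHm]; first by rewrite /series /= !big_geq // addr0 mulr0.
  rewrite doubleS !seriesSr /exp_coeff /= ![_ ^+ m.*2.+1]exprS.
  have even_pow (y : R) : y ^+ m.*2 = (y ^+ 2) ^+ m by rewrite -exprM mul2n.
  rewrite !even_pow sqrrN.
  have term_le : (x ^+ 2) ^+ m / (m.*2)`!%:R <= (x ^+ 2 / 2) ^+ m / m`!%:R.
    rewrite [(_ / 2) ^+ m]exprMn exprVn -mulrA -invfM.
    apply: ler_wpM2l; first by rewrite exprn_ge0 ?sqr_ge0.
    rewrite lef_pV2 ?posrE ?mulr_gt0 ?exprn_gt0 ?ltr0n ?fact_gt0 //.
    by rewrite -natrX -natrM ler_nat fact_double_ge.
  move: IHm; rewrite /exp_coeff /=; lra.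
have double_cvg : (double @ \oo --> \oo)%classic.
  by move=> A [n _ nA]; exists n => // k /= nk; apply: nA => /=; lia.
have cvg_exp (y : R) : (series (exp_coeff y) @ \oo --> expR y)%classic.
  exact: is_cvg_series_exp_coeff.
have cvg_exp2 (y : R) :
    ((fun m => series (exp_coeff y) m.*2) @ \oo --> expR y)%classic.
  exact: (cvg_comp _ _ double_cvg (cvg_exp y)).
apply: ler_cvg_to (cvgD (cvg_exp2 x) (cvg_exp2 (- x)))
  (cvgM (cvg_cst (2 : R)) (cvg_exp (x ^+ 2 / 2))) _.
exact: nearW.
Qed.
(** For [d != 0] this takes the optimal [l = 2 t / d].  For [d = 0] the bounds
    [expR (- l * t)] decay to [0] as [l] grows, which is what the convention
    in [gauss_bound] records. *)
Lemma le_gauss_bound (R : realType) (p t d : R) : 0 <= t -> 0 <= d ->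
  (forall l, 0 <= l -> p <= expR (l ^+ 2 * (d / 4) - l * t)) ->
  p <= gauss_bound t d.
Proof.
move=> t_ge0 d_ge0 p_le; rewrite /gauss_bound; case: eqVneq => [d0|d_neq0].
  have [t0|t_neq0] := eqVneq t 0.
    by have := p_le 0 (lexx 0); rewrite t0 mulr0 subr0 expr0n /= mul0r expR0.
  have t_gt0 : 0 < t by rewrite lt_def t_neq0.
  rewrite leNgt; apply/negP => p_gt0.
  (* At l = 1 / (p t) the bound reads p <= 1 / exp (1 / p) < p. *)
  have := p_le (p * t)^-1; rewrite invr_ge0 mulr_ge0 ?(ltW p_gt0) // => /(_ isT).
  rewrite d0 mul0r mulr0 sub0r invfM mulfVK // expRN.
  have exp_gt : p^-1 < expR p^-1 by apply: lt_le_trans (expR_ge1Dx _); rewrite ltrDr.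
  by rewrite leNgt invf_plt ?posrE ?expR_gt0 ?exp_gt.
have := p_le (2 * t / d); rewrite !mulr_ge0 ?invr_ge0 // => /(_ isT).
by congr (_ <= expR _); field.
Qed.

(** * Uniform means *)

Definition mean (R : realType) (T : finType) (A : {set T}) (X : T -> R) : R :=
  (\sum_(a in A) X a) / #|A|%:R.

Section Mean.
Variables (R : realType) (T : finType) (A : {set T}).
Implicit Types (X Y : T -> R) (k r : R).

Lemma eq_mean X Y : {in A, X =1 Y} -> mean A X = mean A Y.
Proof. by move=> XY; rewrite /mean (eq_bigr _ XY). Qed.

Lemma ler_mean X Y : {in A, forall a, X a <= Y a} -> mean A X <= mean A Y.
Proof. by move=> XY; rewrite ler_wpM2r ?invr_ge0 ?ler0n // ler_sum. Qed.

Lemma mean_mulr X k : mean A (fun a => X a * k) = mean A X * k.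
Proof. by rewrite /mean -mulr_suml mulrAC. Qed.

Hypothesis A_gt0 : (0 < #|A|)%N.

Lemma mean_cst k : mean A (fun=> k) = k.
Proof. by rewrite /mean sumr_const -[k *+ _]mulr_natr mulfK // pnatr_eq0 -lt0n. Qed.

Lemma meanBl X k : mean A (fun a => k - X a) = k - mean A X.
Proof. by rewrite -{2}(mean_cst k) /mean sumrB mulrBl. Qed.

(** Jensen's inequality: average over [a] the tangent bound
    [exp m * (1 + (X a - m)) <= exp (X a)] at the mean [m]. *)
Lemma expR_mean_le X : expR (mean A X) <= mean A (fun a => expR (X a)).
Proof.
rewrite -[leLHS]mulr1; set m := mean A X.
have -> : 1 = mean A (fun a => 1 - (m - X a)) by rewrite !meanBl -/m subrr subr0.
rewrite mulrC -mean_mulr; apply: ler_mean => a _.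
have -> : expR (X a) = expR (X a - m) * expR m by rewrite -expRD subrK.
rewrite ler_wpM2r ?expR_ge0 //.
by apply: le_trans (expR_ge1Dx _); lra.
Qed.

(** A weak form of Hoeffding's lemma, by symmetrization.  Jensen's inequality
    replaces the mean of [X] by the value of [X] at an independent uniform
    point [b], and exchanging [a] and [b] turns [expR (X a - X b)] into a
    hyperbolic cosine. *)
Lemma mean_expR_sub_mean_le X r :
  {in A &, forall a b, `|X a - X b| <= r} ->
  mean A (fun a => expR (X a - mean A X)) <= expR (r ^+ 2 / 2).
Proof.
move=> X_r; pose D a b := expR (X a - X b).
apply: (@le_trans _ _ (mean A (fun a => mean A (D a)))).
  apply: ler_mean => a _; rewrite -meanBl; exact: expR_mean_le.
rewrite -(ler_pM2l (ltr0n R 2)).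
have -> : 2%:R * mean A (fun a => mean A (D a)) =
          mean A (fun a => mean A (fun b => D a b + D b a)).
  have sym : mean A (fun a => mean A (D a)) = mean A (fun a => mean A (D^~ a)).
    by rewrite /mean -!mulr_suml exchange_big.
  rewrite mulr2n mulrDl !mul1r {2}sym /mean -mulrDl -big_split /=.
  by congr (_ / _); apply: eq_bigr => a _; rewrite big_split mulrDl.
rewrite -[leRHS]mean_cst; apply: ler_mean => a aA.
rewrite -[leRHS]mean_cst; apply: ler_mean => b bA.
rewrite /D -(opprB (X a)); apply: le_trans (expRDexpRN_le _) _.
rewrite ler_wpM2l // ler_expR ler_wpM2r ?invr_ge0 //.
rewrite -real_normK ?num_real // lerXn2r ?nnegrE //; last exact: X_r.
exact: le_trans (X_r a b aA bA).
Qed.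

End Mean.

(** * Uniform subsets of fixed size *)

Definition draws (T : finType) (B : {set T}) (u : nat) : {set {set T}} :=
  [set U : {set T} | U \subset B & #|U| == u].

Section Draws.
Variables (R : realType) (T : finType) (u : nat).
Implicit Types (B U : {set T}) (F : {set T} -> R).

(** Discarding a uniform point first does not change the law of a uniform
    [u]-subset: each [U] of size [u] in [B] arises from the [#|B| - u] points
    outside it. *)
Lemma mean_draws_tower B F : (u < #|B|)%N ->
  mean (draws B u) F = mean B (fun a => mean (draws (B :\ a) u) F).
Proof.
move=> uB; set m := #|B|.
have cardB1 a : a \in B -> #|B :\ a| = m.-1 by rewrite /m [#|B|](cardsD1 a) => ->.
have -> : mean B (fun a => mean (draws (B :\ a) u) F) =
    (\sum_(a in B) \sum_(U in draws (B :\ a) u) F U) / 'C(m.-1, u)%:R / m%:R.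
  rewrite /mean [in RHS]mulr_suml; congr (_ / _); apply: eq_bigr => a aB.
  by rewrite cards_draws cardB1.
rewrite (exchange_big_dep (mem (draws B u))) /=; last first.
  by move=> a U _; rewrite !inE subsetD1 -andbA => /and3P[-> _ ->].
have -> : \sum_(U in draws B u) \sum_(a in B | U \in draws (B :\ a) u) F U =
          (\sum_(U in draws B u) F U) * (m - u)%:R.
  rewrite mulr_suml; apply: eq_bigr => U; rewrite !inE => /andP[UB /eqP Uu].
  rewrite -Uu -cardsDS // mulr_natr -sumr_const; apply: eq_bigl => a.
  by rewrite !inE subsetD1 UB Uu eqxx andbT andbC.
have mne0 : m%:R != 0 :> R by rewrite pnatr_eq0 -lt0n (leq_ltn_trans _ uB).
have bin0 : 'C(m.-1, u)%:R != 0 :> R.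
  by rewrite pnatr_eq0 -lt0n bin_gt0 -ltnS prednK // (leq_ltn_trans _ uB).
have bin1 : 'C(m, u)%:R != 0 :> R by rewrite pnatr_eq0 -lt0n bin_gt0 ltnW.
have bin_eq : m%:R * 'C(m.-1, u)%:R = (m - u)%:R * 'C(m, u)%:R :> R.
  by rewrite -!natrM mul_bin_down.
rewrite /mean cards_draws -/m -mulrA -mulrA; congr (_ * _).
apply: (mulIf bin1); rewrite mulVf // -mulrA mulrC -!mulrA.
rewrite [X in _ * (_ * X)]mulrC -bin_eq; field.
by rewrite mne0 bin0.
Qed.

(** The [u]-subsets that avoid both [a] and [b] count equally in the two means.
    The transposition of [a] and [b] matches those of [B :\ a] that contain [b]
    with those of [B :\ b] that contain [a], at a cost of [c] for each pair;
    they make up a proportion [u / (#|B| - 1)] of the whole. *)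
Lemma mean_draws_swap B F (c : R) a b :
  (forall U a b, #|U| = u -> a \notin U -> b \in U ->
     `|F U - F (tperm a b @^-1: U)| <= c) ->
  0 <= c -> (u < #|B|)%N -> a \in B -> b \in B ->
  `|mean (draws (B :\ a) u) F - mean (draws (B :\ b) u) F|
     <= c * u%:R / #|B|.-1%:R.
Proof.
move=> F_lip c_ge0 uB aB bB.
have [->|ab] := eqVneq a b.
  by rewrite subrr normr0 !mulr_ge0 ?invr_ge0 ?ler0n.
set m := #|B|.
pose h U := tperm a b @^-1: U.
have hK : involutive h by move=> U; apply/setP => z; rewrite !inE tpermK.
have hS A V : (h V \subset h A) = (V \subset A).
  apply/idP/idP => [hVA|]; last exact: preimsetS.
  by rewrite -(hK V) -(hK A); exact: preimsetS.
have cardB1 z : z \in B -> #|B :\ z| = m.-1 by rewrite /m [#|B|](cardsD1 z) => ->.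
have split_sum a' b' : \sum_(U in draws (B :\ a') u) F U =
    \sum_(U in draws (B :\ a') u | b' \in U) F U +
    \sum_(U in draws (B :\ a' :\ b') u) F U.
  rewrite (bigID (fun U : {set T} => b' \in U)) /=; congr (_ + _).
  apply: eq_bigl => U; rewrite !inE [in RHS]subsetD1; exact: andbAC.
have hB : h (B :\ b) = B :\ a.
  apply/setP => z; rewrite !inE; case: tpermP => [->|->|/eqP za /eqP zb].
  - by rewrite !eqxx.
  - by rewrite aB bB eq_sym.
  - by rewrite za zb.
have reind : \sum_(U in draws (B :\ b) u | a \in U) F U =
             \sum_(U in draws (B :\ a) u | b \in U) F (h U).
  rewrite (reindex_inj (can_inj hK)) /=; apply: eq_bigl => U.
  rewrite !inE tpermL card_preimset; last exact: perm_inj.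
  by rewrite -[in LHS](hK (B :\ b)) hB hS.
rewrite {1 2}/mean !cards_draws !cardB1 // -mulrBl.
rewrite (split_sum a b) (split_sum b a) reind (setDDl _ [set a]) setUC -setDDl.
rewrite opprD addrACA subrr addr0 -sumrB normrM.
rewrite [X in _ * X]ger0_norm ?invr_ge0 ?ler0n //.
have u_le : (u <= m.-1)%N by rewrite -ltnS prednK // (leq_ltn_trans _ uB).
have bin_gt0 : 0 < 'C(m.-1, u)%:R :> R by rewrite ltr0n bin_gt0.
have m1_gt0 : 0 < m.-1%:R :> R.
  rewrite ltr0n -(cardB1 a) // card_gt0; apply/set0Pn; exists b.
  by rewrite !inE eq_sym ab.
have count : #|[set U in draws (B :\ a) u | b \in U]|%:R * m.-1%:R =
             u%:R * 'C(m.-1, u)%:R :> R.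
  have cardD : (#|[set U in draws (B :\ a) u | b \in U]| + 'C(m.-2, u) = 'C(m.-1, u))%N.
    rewrite -(cardB1 a) // -cards_draws -/(draws _ _).
    rewrite -(cardsID [set U : {set T} | b \in U] (draws _ _)); congr (_ + _)%N.
      by apply: eq_card => U; rewrite !inE.
    have -> : #|B :\ a|.-1 = #|B :\ a :\ b|.
      by rewrite (cardsD1 b (B :\ a)) in_setD1 eq_sym ab bB.
    rewrite -cards_draws; apply: eq_card => U.
    by rewrite !inE [in LHS]subsetD1 andbAC andbC.
  have := mul_bin_down m.-1 u; rewrite mulnBl => down.
  have le_mul : (u * 'C(m.-1, u) <= m.-1 * 'C(m.-1, u))%N by rewrite leq_mul2r u_le orbT.
  have := congr1 (muln m.-1) cardD; rewrite mulnDr => cardDM.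
  by rewrite -!natrM; congr (_ %:R); lia.
rewrite ler_pdivrMr // mulrAC ler_pdivlMr //.
apply: (@le_trans _ _ (\sum_(U in [set U in draws (B :\ a) u | b \in U]) c * m.-1%:R)).
  rewrite -mulr_suml ler_wpM2r ?ler0n //; apply: le_trans (ler_norm_sum _ _ _) _.
  under [leRHS]eq_bigl do rewrite inE.
  apply: ler_sum => U; rewrite !inE subsetD1 => /andP[/andP[/andP[_ aU] /eqP Uu] bU].
  exact: F_lip.
by rewrite sumr_const -[_ *+ _]mulr_natr mulrAC -!mulrA count.
Qed.

(** The exponent vanishes when [B] has only one [u]-subset, and going from
    size [m] to [m + 1] it grows by [c^2 u^2 / (m (m + 1))], which is at least
    the contribution [(c u / m)^2 / 2] of the discarded point. *)
Lemma mean_draws_expR_le F (c : R) B :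
  (forall U a b, #|U| = u -> a \notin U -> b \in U ->
     `|F U - F (tperm a b @^-1: U)| <= c) ->
  0 <= c -> (u <= #|B|)%N ->
  mean (draws B u) (fun U => expR (F U - mean (draws B u) F))
    <= expR (c ^+ 2 * (u%:R - u%:R ^+ 2 / #|B|%:R)).
Proof.
move=> F_lip c_ge0; move: {2}(#|B| - u)%N (erefl (#|B| - u)%N) => k.
elim: k B => [|k IHk] B Bu uB.
  have {uB}uB : #|B| = u by lia.
  have -> : draws B u = [set B].
    apply/setP => U; rewrite !inE; apply/andP/eqP => [[UB /eqP Uu]|->].
      by apply/eqP; rewrite eqEcard UB uB Uu leqnn.
    by rewrite uB.
  rewrite /mean !big_set1 cards1 !divr1 subrr expR0 uB.
  have [->|u0] := eqVneq (u%:R : R) 0; first by rewrite expr0n mul0r subrr mulr0 expR0.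
  by rewrite expr2 mulfK // subrr mulr0 expR0.
have {}uB : (u < #|B|)%N by lia.
have B_gt0 : (0 < #|B|)%N by apply: leq_ltn_trans uB.
have cardB1 a : a \in B -> #|B :\ a| = #|B|.-1 by rewrite [#|B|](cardsD1 a) => ->.
set mu := mean (draws B u) F; pose X a := mean (draws (B :\ a) u) F.
have muE : mu = mean B X by exact: mean_draws_tower.
set v := c ^+ 2 * (u%:R - u%:R ^+ 2 / #|B|.-1%:R).
set r := c * u%:R / #|B|.-1%:R.
rewrite mean_draws_tower //.
apply: (@le_trans _ _ (mean B (fun a => expR (X a - mu) * expR v))).
  apply: ler_mean => a aB.
  rewrite mulrC /v -(cardB1 a aB).
  apply: le_trans (ler_wpM2r (expR_ge0 _) (IHk (B :\ a) _ _)).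
  - rewrite -mean_mulr; apply: ler_mean => U _.
    by rewrite -expRD addrA subrK.
  - by rewrite cardB1 //; lia.
  - by rewrite cardB1 //; lia.
rewrite mean_mulr muE; apply: (@le_trans _ _ (expR (r ^+ 2 / 2) * expR v)).
  rewrite ler_wpM2r ?expR_ge0 //; apply: mean_expR_sub_mean_le => // a b aB bB.
  exact: mean_draws_swap.
rewrite -expRD ler_expR /r /v; move: B_gt0 uB; case: #|B| => // m _ /=.
rewrite ltnS => um; have [u0|u_gt0] := posnP u.
  by rewrite u0 mulr0 !mul0r !expr0n /= !mul0r subrr mulr0 addr0.
have m_ge1 : (1 : R) <= m%:R by rewrite ler1n; lia.
have m1E : m.+1%:R = m%:R + 1 :> R by rewrite -natr1.
rewrite m1E; set M : R := m%:R in m_ge1 *; set V : R := u%:R.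
have MV : (M + 1)^-1 = M^-1 - (M * (M + 1))^-1 by field; apply/andP; split; lra.
have half : (M ^+ 2)^-1 / 2 <= (M * (M + 1))^-1.
  rewrite -invfM lef_pV2 ?posrE; nra.
rewrite MV; have := ler_wpM2l (mulr_ge0 (sqr_ge0 c) (sqr_ge0 V)) half.
rewrite !exprMn exprVn; lra.
Qed.

End Draws.

(** * Uniform laws from random permutations *)

(** Both sides are compared with the double average over [y] in the orbit and
    [g] in the group: the inner average over [g] is the same for all [y], and
    each [g] permutes the orbit. *)
Lemma mean_orbit (R : realType) (aT : finGroupType) (T : finType)
    (to : {action aT &-> T}) (x : T) (X : T -> R) :
  mean [set: aT] (fun g => X (to x g)) = mean (orbit to [set: aT] x) X.
Proof.
set O := orbit to _ x.
have to_x : \sum_(y in O) \sum_(g in [set: aT]) X (to y g) =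
            (\sum_(g in [set: aT]) X (to x g)) * #|O|%:R.
  rewrite mulr_natr -sumr_const; apply: eq_bigr => y /orbitP[h _ <-].
  rewrite [RHS](reindex_inj (mulgI h)) /=; apply: eq_big => g; first by rewrite !inE.
  by rewrite actM.
have to_O : \sum_(y in O) \sum_(g in [set: aT]) X (to y g) =
            (\sum_(y in O) X y) * #|[set: aT]|%:R.
  rewrite mulr_natr -sumr_const exchange_big; apply: eq_bigr => g _.
  rewrite [RHS](reindex_inj (act_inj to g)) /=; apply: eq_bigl => y.
  by rewrite /O orbit_actr ?inE // orbit_refl.
rewrite /mean; apply/eqP; rewrite eqr_div -?to_x ?to_O // pnatr_eq0 -lt0n.
  by rewrite cardG_gt0.
by apply/card_gt0P; exists x; exact: orbit_refl.
Qed.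

Section Words.
Variables (n : nat) (C : finType).

(** Words compose with permutations on the inside, so the inverse is what makes
    this a right action. *)
Definition shuffle (w : {ffun 'I_n -> C}) (s : 'S_n) : {ffun 'I_n -> C} :=
  [ffun i => w (s^-1 i)%g].

Lemma shuffle1 : shuffle^~ 1%g =1 id.
Proof. by move=> w; apply/ffunP => i; rewrite ffunE invg1 perm1. Qed.

Lemma shuffleM w s t : shuffle w (s * t)%g = shuffle (shuffle w s) t.
Proof. by apply/ffunP => i; rewrite !ffunE invMg permM. Qed.

Canonical shuffle_action := TotalAction shuffle1 shuffleM.

End Words.

Lemma perm_eq_codom (C : eqType) n (w w' : 'I_n -> C) :
  perm_eq (codom w) (codom w') -> exists s : 'S_n, forall i, w i = w' (s i).
Proof.
have codomE (v : 'I_n -> C) : codom v = [tuple v i | i < n] by [].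
rewrite (codomE w') => /tuple_permP[s codom_w]; exists s => i.
have := congr1 (fun r : seq C => nth (w i) r i) codom_w; rewrite codomE.
by rewrite -!tnth_nth !tnth_mktuple.
Qed.

(** List the values of [phi] and then the remaining points. *)
Lemma extend_inj n N (le_nN : (n <= N)%N) (phi : 'I_n -> 'I_N) :
  injective phi -> exists s : 'S_N, forall i, s (widen_ord le_nN i) = phi i.
Proof.
move=> phi_inj; pose r := codom phi ++ enum [predC codom phi].
have r_enum : perm_eq r (enum 'I_N).
  apply: uniq_perm; rewrite ?enum_uniq //.
    rewrite cat_uniq enum_uniq andbT; apply/andP; split; first exact/injectiveP.
    by apply/hasPn => i; rewrite mem_enum.
  by move=> i; rewrite mem_cat !mem_enum inE orbN.
have szr : size r = N by rewrite (perm_size r_enum) size_enum_ord.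
have r_uniq : uniq r by rewrite (perm_uniq r_enum) enum_uniq.
have nth_inj : injective (fun i : 'I_N => nth i r i).
  move=> i j /eqP; rewrite (set_nth_default j) ?szr // nth_uniq ?szr //.
  by move/eqP/val_inj.
exists (perm nth_inj) => i; rewrite permE /= nth_cat size_codom card_ord ltn_ord.
have -> : codom phi = [tuple phi i | i < n] by [].
by rewrite nth_mktuple.
Qed.

(** * From samples to subsets of positions *)

Section Sampling.
Variables (R : realType) (L : nat) (kappa : 'I_L -> nat) (x : L.-tuple R).
Local Notation N := (slice_size kappa).
Local Notation Omega := (multislice kappa x).
Variables (n : nat) (n_gt0 : (0 < n)%N) (le_nN : (n <= N)%N).
Local Notation Sample := (sample x le_nN).
Local Notation first w := (first_coords le_nN w).

Implicit Types (w : word x N) (s : 'S_N).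

(** A sample is read off a word along an injection of coordinates into
    positions; the sample itself is the case of [widen_ord]. *)
Definition read w (phi : 'I_n -> 'I_N) : word x n := [ffun i => w (phi i)].

Lemma shuffle_multislice w s : (shuffle w s \in Omega) = (w \in Omega).
Proof.
rewrite !inE; apply: eq_forallb => l; congr (_ == _).
rewrite -(card_preimset [set i | val (shuffle w s i) == tnth x l] (@perm_inj _ s)).
by apply: eq_card => i; rewrite !inE ffunE permK.
Qed.

(** Two words in which every value occurs equally often differ by a permutation
    of the positions. *)
Lemma multislice_orbit w : w \in Omega ->
  Omega = orbit (shuffle_action _ _) [set: 'S_N] w.
Proof.
move=> w_slice; apply/setP => v; apply/idP/orbitP => [v_slice|[s _ <-]]; last first.
  by rewrite shuffle_multislice.
have count_codom u y : count_mem y (codom u) = #|[set i | u i == y]|.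
  rewrite /codom /image_mem count_map cardsE cardE size_filter enumT.
  by apply: eq_count.
have /perm_eq_codom[s vE] : perm_eq (codom v) (codom w).
  apply/allP => y _ /=; rewrite !count_codom //; have /tnthP[l yE] := valP y.
  have in_val u : #|[set i | u i == y]| = #|[set i | val (u i) == tnth x l]|.
    by apply: eq_card => i; rewrite !inE -yE.
  move: v_slice w_slice; rewrite !inE !in_val.
  move=> /forallP/(_ l)/eqP-> /forallP/(_ l)/eqP->.
  exact: eqxx.
exists s^-1%g; rewrite ?inE //; apply/ffunP => i.
by rewrite ffunE invgK vE.
Qed.

Lemma mean_shuffle s X : mean Omega (fun w => X (shuffle w s)) = mean Omega X :> R.
Proof.
rewrite /mean; congr (_ / _); rewrite [RHS](reindex_inj (act_inj (shuffle_action _ _) s)).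
by apply: eq_bigl => w; rewrite shuffle_multislice.
Qed.

Lemma sample_probE (A : {set word x n}) :
  sample_prob le_nN A = mean Omega (fun w => (first w \in A)%:R).
Proof.
rewrite /sample_prob /multislice_prob /mean -sum1_card natr_sum big_mkcond.
rewrite [in RHS]big_mkcond /=; congr (_ / _); apply: eq_bigr => w _.
rewrite in_setI andbC; case: (w \in Omega) => //=; rewrite inE; by case: (_ \in A).
Qed.

Lemma first_sample w : w \in Omega -> first w \in Sample.
Proof. exact: imset_f. Qed.

Lemma sample_expectE (f : word x n -> R) :
  sample_expect le_nN f = mean Omega (fun w => f (first w)).
Proof.
rewrite /sample_expect; under eq_bigr do rewrite sample_probE /mean mulrA.
rewrite -mulr_suml; congr (_ / _); under eq_bigr do rewrite mulr_sumr.
rewrite exchange_big; apply: eq_bigr => w w_slice /=.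
rewrite (bigD1 (first w)) ?first_sample //= inE eqxx mulr1.
rewrite big1 ?addr0 // => v /andP[_ v_w].
by rewrite inE eq_sym (negPf v_w) mulr0.
Qed.

Lemma first_shuffle w s :
  first (shuffle w s) = read w (fun i => s^-1%g (widen_ord le_nN i)).
Proof. by apply/ffunP => i; rewrite !ffunE. Qed.

Lemma read_inj phi : injective phi ->
  exists s, forall v, read v phi = first (shuffle v s).
Proof.
move=> /(extend_inj le_nN)[s sE]; exists s^-1%g => v.
by apply/ffunP => i; rewrite !ffunE invgK sE.
Qed.

Lemma read_sample w phi : w \in Omega -> injective phi -> read w phi \in Sample.
Proof.
move=> w_slice /read_inj[s ->].
by rewrite first_sample // shuffle_multislice.
Qed.

Lemma permute_read (r : 'S_n) w phi : permute r (read w phi) = read w (phi \o r).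
Proof. by apply/ffunP => i; rewrite !ffunE. Qed.

Lemma sampleP (v : word x n) :
  reflect (exists2 w, w \in Omega & v = read w (widen_ord le_nN)) (v \in Sample).
Proof. exact: imsetP. Qed.

Lemma widen_inj : injective (widen_ord le_nN).
Proof. by move=> i j /(congr1 val) /= /val_inj. Qed.

Lemma permute_sample (r : 'S_n) v : v \in Sample -> permute r v \in Sample.
Proof.
case/sampleP => w w_slice ->; rewrite permute_read read_sample //.
exact: inj_comp widen_inj (@perm_inj _ r).
Qed.

Lemma sample_expect_permute (r : 'S_n) (f : word x n -> R) :
  sample_expect le_nN (fun v => f (permute r v)) = sample_expect le_nN f.
Proof.
rewrite !sample_expectE.
have [s sE] := read_inj (inj_comp widen_inj (@perm_inj _ r)).
rewrite -[RHS](mean_shuffle s); apply: eq_mean => w _.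
by rewrite -sE -permute_read.
Qed.

Lemma im_perm_setC (T : finType) (s : {perm T}) (A : {set T}) :
  s @: (~: A) = ~: (s @: A).
Proof. by rewrite -!preim_permV preimsetC. Qed.

(** [U] is the set of positions left out of the sample. *)
Definition positions (U : {set 'I_N}) (i : 'I_n) : 'I_N :=
  nth (widen_ord le_nN (Ordinal n_gt0)) (enum (~: U)) i.

Lemma positionsP (U : {set 'I_N}) : #|U| = (N - n)%N ->
  injective (positions U) /\ [set positions U i | i : 'I_n] = ~: U.
Proof.
move=> cardU; have cardUC : #|~: U| = n.
  by have := cardsC U; rewrite cardU card_ord; lia.
have inj : injective (positions U).
  move=> i j /eqP; rewrite nth_uniq ?enum_uniq -?cardE ?cardUC //.
  by move/eqP/val_inj.
split=> //; apply/eqP; rewrite eqEcard card_imset // cardUC card_ord leqnn andbT.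
apply/subsetP => _ /imsetP[i _ ->].
by rewrite -mem_enum mem_nth // -cardE cardUC.
Qed.

(** Two enumerations of the same positions differ by a permutation of the
    coordinates. *)
Lemma read_image (f : word x n -> R) w phi psi :
  (forall (s : 'S_n) v, v \in Sample -> f (permute s v) = f v) ->
  w \in Omega -> injective phi -> injective psi ->
  [set phi i | i : 'I_n] = [set psi i | i : 'I_n] ->
  f (read w phi) = f (read w psi).
Proof.
move=> f_sym w_slice phi_inj psi_inj im_eq.
have /perm_eq_codom[s phiE] : perm_eq (codom phi) (codom psi).
  apply: uniq_perm; [exact/injectiveP | exact/injectiveP | move=> j].
  have mem_codom (chi : 'I_n -> 'I_N) : (j \in codom chi) = (j \in [set chi i | i : 'I_n]).
    by apply/codomP/imsetP => [[i ->]|[i _ ->]]; exists i.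
  by rewrite !mem_codom im_eq.
rewrite -(f_sym s (read w psi)) ?read_sample // permute_read.
by congr f; apply/ffunP => i; rewrite !ffunE phiE.
Qed.

(** Transitivity holds because an enumeration of the complement of [U] and one
    of the complement of [V] both extend to permutations of all positions. *)
Lemma orbit_draws (U : {set 'I_N}) : #|U| = (N - n)%N ->
  orbit ('P^*)%act [set: 'S_N] U = draws [set: 'I_N] (N - n).
Proof.
move=> cardU; apply/setP => V; rewrite inE subsetT /=.
apply/orbitP/eqP => [[s _ <-]|cardV].
  by rewrite /= setactE card_imset //; exact: act_inj.
have [phi_inj phi_im] := positionsP cardU; have [psi_inj psi_im] := positionsP cardV.
have [s sE] := extend_inj le_nN phi_inj; have [r rE] := extend_inj le_nN psi_inj.
exists (s^-1 * r)%g; rewrite ?inE //=; apply: setC_inj; rewrite -im_perm_setC.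
rewrite -phi_im -psi_im -imset_comp; apply: eq_imset => i /=.
by rewrite permM -sE permK rE.
Qed.

(** Both means are averages over the symmetric group, one along the orbit of
    [w] and the other along the orbit of the set [U0] of left-out positions;
    a symmetric [f] only sees where the permutation sends [U0]. *)
Lemma mean_first_draws (f : word x n -> R) (g : R -> R) w :
  (forall (s : 'S_n) v, v \in Sample -> f (permute s v) = f v) ->
  w \in Omega ->
  mean Omega (fun v => g (f (first v))) =
  mean (draws [set: 'I_N] (N - n)) (fun U => g (f (read w (positions U)))).
Proof.
move=> f_sym w_slice.
pose U0 := ~: [set widen_ord le_nN i | i : 'I_n].
have cardU0 : #|U0| = (N - n)%N.
  by rewrite cardsCs setCK card_imset ?card_ord //; exact: widen_inj.
rewrite {1}(multislice_orbit w_slice) -mean_orbit -(orbit_draws cardU0) -mean_orbit.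
rewrite /mean; congr (_ / _); rewrite [RHS](reindex_inj invg_inj) /=.
apply: eq_big => [s|s _]; first by rewrite !inE.
congr g; rewrite first_shuffle.
have cardU : #|s^-1%g @: U0| = (N - n)%N.
  by rewrite -cardU0 card_imset //; exact: perm_inj.
have [phi_inj phi_im] := positionsP cardU.
apply: read_image => //; first exact: inj_comp (@perm_inj _ _) widen_inj.
by rewrite phi_im -im_perm_setC setCK -imset_comp.
Qed.

(** By symmetry the sample may be read along an injection [phi] whose first
    value is [a], and then the swap replaces the first coordinate only. *)
Lemma read_positions_lip (f : word x n -> R) (c : R) w :
  (forall (s : 'S_n) v, v \in Sample -> f (permute s v) = f v) ->
  (forall v y, v \in Sample -> replace v (Ordinal n_gt0) y \in Sample ->
     `|f v - f (replace v (Ordinal n_gt0) y)| <= c) ->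
  w \in Omega ->
  forall (U : {set 'I_N}) a b, #|U| = (N - n)%N -> a \notin U -> b \in U ->
    `|f (read w (positions U)) - f (read w (positions (tperm a b @^-1: U)))| <= c.
Proof.
move=> f_sym f_lip w_slice U a b cardU aU bU; set i0 := Ordinal n_gt0 in f_lip.
set V := tperm a b @^-1: U.
have cardV : #|V| = (N - n)%N by rewrite card_preimset //; exact: perm_inj.
have [U_inj U_im] := positionsP cardU; have [V_inj V_im] := positionsP cardV.
have /imsetP[i _ aE] : a \in [set positions U i | i : 'I_n] by rewrite U_im inE.
pose phi := positions U \o tperm i0 i.
have phi_inj : injective phi by exact: inj_comp U_inj (@perm_inj _ _).
have phi_im : [set phi j | j : 'I_n] = ~: U.
  apply/eqP; rewrite eqEcard -U_im !card_imset // leqnn andbT.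
  by apply/subsetP => _ /imsetP[j _ ->]; apply: imset_f.
pose psi := tperm a b \o phi.
have psi_inj : injective psi by exact: inj_comp (@perm_inj _ _) phi_inj.
have psi_im : [set psi j | j : 'I_n] = ~: V.
  by rewrite /V -[tperm a b]tpermV preim_permV -im_perm_setC -phi_im -imset_comp.
rewrite (read_image f_sym w_slice U_inj phi_inj) ?U_im ?phi_im //.
rewrite (read_image f_sym w_slice V_inj psi_inj) ?V_im ?psi_im //.
have psiE : read w psi = replace (read w phi) i0 (w b).
  apply/ffunP => j; rewrite !ffunE /psi /=; case: eqVneq => [->|j_i0].
    by rewrite /phi /= tpermL -aE tpermL.
  rewrite tpermD //.
    by apply: contraNneq j_i0 => ajE; apply/eqP/phi_inj; rewrite -ajE /phi /= tpermL.
  apply: contraTneq bU => ->; rewrite -in_setC -phi_im; exact: imset_f.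
by rewrite psiE; apply: f_lip; rewrite -?psiE read_sample.
Qed.

(** * Tail bounds *)

(** Markov's inequality for [expR (l * f)], before [l] is optimized: the bound
    is monotone in the variance factor, so a larger one can still be
    substituted, and the limit of large [l] remains available. *)
Lemma symmetric_tail_le (f : word x n -> R) (c : R) :
  (forall (s : 'S_n) v, v \in Sample -> f (permute s v) = f v) -> 0 <= c ->
  (forall v y, v \in Sample -> replace v (Ordinal n_gt0) y \in Sample ->
     `|f v - f (replace v (Ordinal n_gt0) y)| <= c) ->
  forall t l, 0 <= l ->
  sample_prob le_nN [set v in Sample | t <= f v - sample_expect le_nN f] <=
  expR (l ^+ 2 * ((1 - n%:R / N%:R) * c ^+ 2 * n%:R) - l * t).
Proof.
move=> f_sym c_ge0 f_lip t l l_ge0; rewrite sample_probE.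
have [Om0|[w w_slice]] := set_0Vmem Omega.
  by rewrite /mean Om0 big_set0 mul0r expR_ge0.
pose F U := l * f (read w (positions U)).
set mu := sample_expect le_nN f.
have muE : l * mu = mean (draws [set: 'I_N] (N - n)) F.
  rewrite /mu sample_expectE (mean_first_draws id f_sym w_slice) mulrC -mean_mulr.
  by apply: eq_mean => U _; rewrite mulrC.
apply: (@le_trans _ _ (mean Omega
  (fun v => expR (l * f (first v) - l * mu) * expR (- (l * t))))).
  apply: ler_mean => v _; rewrite inE; case: (boolP (_ && _)) => [/andP[_ tf]|_].
    rewrite -expRD -expR0 ler_expR -mulrBr -mulrBr mulr_ge0 //; lra.
  by rewrite mulr_ge0 ?expR_ge0.
rewrite mean_mulr (mean_first_draws (fun r => expR (l * r - l * mu)) f_sym w_slice).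
rewrite expRD ler_wpM2r ?expR_ge0 // muE.
have := @mean_draws_expR_le _ _ (N - n) F (l * c) [set: 'I_N].
rewrite cardsT card_ord leq_subr mulr_ge0 // => /(_ _ isT isT) F_le.
apply: (le_trans (F_le _)) => [U a b cardU aU bU|].
  rewrite /F -mulrBr normrM (ger0_norm l_ge0) ler_wpM2l //.
  exact: read_positions_lip.
rewrite ler_expR natrB // le_eqVlt; apply/orP; left; apply/eqP.
have N_neq0 : N%:R != 0 :> R by rewrite pnatr_eq0 -lt0n (leq_trans n_gt0).
by field.
Qed.

End Sampling.

Lemma replace_permute (R : realType) (L : nat) (x : L.-tuple R) (n : nat)
    (s : 'S_n) (w : word x n) i y :
  permute s (replace w i y) = replace (permute s w) (s^-1 i)%g y.
Proof.
apply/ffunP => j; rewrite !ffunE; congr (if _ then _ else _).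
by rewrite -(inj_eq (@perm_inj _ s^-1)) permK.
Qed.

(** This is [mean_orbit] for the transitive action on the points. *)
Lemma mean_perm (R : realType) n (c : 'I_n -> R) i :
  (n`!%:R)^-1 * (\sum_(s : 'S_n) c (s^-1 i)%g) = (\sum_j c j) / n%:R.
Proof.
have := mean_orbit 'P%act i c; rewrite /mean.
have -> : orbit 'P%act [set: 'S_n] i = [set: 'I_n].
  apply/setP => j; rewrite inE; apply/orbitP; exists (tperm i j) => //.
  by rewrite /= apermE tpermL.
have sumT (T : finType) (X : T -> R) : \sum_(a in [set: T]) X a = \sum_a X a.
  by apply: eq_bigl => a; rewrite inE.
rewrite !sumT (cardsT 'I_n) card_ord => <-.
have -> : #|[set: 'S_n]| = n`! by rewrite cardsT card_Sn.
rewrite mulrC [in LHS](reindex_inj invg_inj) /=; congr (_ / _).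
by apply: eq_bigr => s _; rewrite invgK.
Qed.

(** Expand the sum of the squared deviations from the mean. *)
Lemma sqr_sum_le (R : realFieldType) n (c : 'I_n -> R) :
  ((\sum_i c i) / n%:R) ^+ 2 * n%:R <= \sum_i c i ^+ 2.
Proof.
case: n c => [|n] c; first by rewrite mulr0 big_ord0.
set cbar := (\sum_i c i) / n.+1%:R; have sum_dev_ge0 : 0 <= \sum_i (c i - cbar) ^+ 2.
  by apply: sumr_ge0 => i _; apply: sqr_ge0.
have sumE : \sum_i c i = cbar * n.+1%:R.
  by rewrite /cbar mulfVK // pnatr_eq0.
move: sum_dev_ge0; under eq_bigr do rewrite sqrrB -mulrnAl -mulr_natl.
rewrite big_split sumrB /= -mulr_suml -mulr_sumr sumE sumr_const card_ord -mulr_natr.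
lra.
Qed.

Theorem proposition1p4 (R : realType) (L : nat) (kappa : 'I_L -> nat)
    (x : L.-tuple R) (n : nat) (L_ge2 : (2 <= L)%N)
    (kappa_gt0 : forall l : 'I_L, (0 < kappa l)%N) (x_uniq : uniq x)
    (n_gt0 : (0 < n)%N) (le_nN : (n <= slice_size kappa)%N) :
  (forall (f : word x n -> R) (c : 'I_n -> R),
     (forall (i : 'I_n) (w : word x n) (y : seq_sub x),
        w \in sample x le_nN -> replace w i y \in sample x le_nN ->
        `|f w - f (replace w i y)| <= c i) ->
     forall t : R, 0 <= t ->
       sample_prob le_nN
         [set w in sample x le_nN
           | t <= symmetrize f w - sample_expect le_nN f]
       <= gauss_bound t
            (4 * (1 - n%:R / (slice_size kappa)%:R) * \sum_(i < n) c i ^+ 2)) /\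
  (forall (f : word x n -> R) (c : R),
     (forall (s : 'S_n) (w : word x n),
        w \in sample x le_nN -> f (permute s w) = f w) ->
     0 < c ->
     (forall (w : word x n) (y : seq_sub x),
        w \in sample x le_nN ->
        replace w (Ordinal n_gt0) y \in sample x le_nN ->
        `|f w - f (replace w (Ordinal n_gt0) y)| <= c) ->
     forall t : R, 0 <= t ->
       sample_prob le_nN
         [set w in sample x le_nN | t <= f w - sample_expect le_nN f]
       <= gauss_bound t
            (4 * (1 - n%:R / (slice_size kappa)%:R) * c ^+ 2 * n%:R)).
Proof.
have N_gt0 : 0 < (slice_size kappa)%:R :> R by rewrite ltr0n (leq_trans n_gt0).
have ratio_ge0 : 0 <= 1 - n%:R / (slice_size kappa)%:R :> R.
  by rewrite subr_ge0 ler_pdivrMr // mul1r ler_nat.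
split=> [f c f_lip t t_ge0|f c f_sym c_gt0 f_lip t t_ge0]; last first.
  apply: le_gauss_bound => // [|l l_ge0]; first by rewrite !mulr_ge0 ?(ltW c_gt0).
  have := symmetric_tail_le f_sym (ltW c_gt0) f_lip t l_ge0.
  by congr (_ <= expR _); field; rewrite gt_eqF.
(* A sample is needed to see that the constants c i are nonnegative. *)
have [Om0|[w0 w0_slice]] := set_0Vmem (multislice kappa x).
  rewrite sample_probE /mean Om0 big_set0 mul0r /gauss_bound.
  by case: ifP => _; rewrite ?ler0n ?expR_ge0.
have c_ge0 i : 0 <= c i.
  set v := first_coords le_nN w0; have v_sample : v \in sample x le_nN.
    exact: first_sample.
  apply: le_trans (normr_ge0 _) (f_lip i v (v i) v_sample _).
  have -> // : replace v i (v i) = v.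
  by apply/ffunP => j; rewrite ffunE; case: eqP => [->|].
set cbar := (\sum_i c i) / n%:R.
have sym_sym (s : 'S_n) w : w \in sample x le_nN ->
    symmetrize f (permute s w) = symmetrize f w.
  move=> _; rewrite /symmetrize; congr (_ * _).
  rewrite [RHS](reindex_inj (mulIg s)) /=; apply: eq_bigr => r _.
  by congr f; apply/ffunP => i; rewrite !ffunE permM.
have sym_lip w y : w \in sample x le_nN ->
    replace w (Ordinal n_gt0) y \in sample x le_nN ->
    `|symmetrize f w - symmetrize f (replace w (Ordinal n_gt0) y)| <= cbar.
  (* Permuting by s moves coordinate 0 to s^-1 0, so the c (s^-1 0) are averaged. *)
  move=> w_sample wy_sample; rewrite /symmetrize -mulrBr -sumrB normrM.
  rewrite ger0_norm ?invr_ge0 ?ler0n // /cbar -(mean_perm c (Ordinal n_gt0)).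
  rewrite ler_wpM2l ?invr_ge0 ?ler0n //; apply: le_trans (ler_norm_sum _ _ _) _.
  apply: ler_sum => s _; rewrite replace_permute.
  apply: f_lip; first exact: permute_sample.
  by rewrite -replace_permute; exact: permute_sample.
have expect_sym : sample_expect le_nN (symmetrize f) = sample_expect le_nN f.
  rewrite {1}/sample_expect /symmetrize.
  under eq_bigr do rewrite -mulrA mulr_suml.
  rewrite -mulr_sumr exchange_big /=.
  under eq_bigr do rewrite -/(sample_expect le_nN (fun v => f (permute _ v)))
    sample_expect_permute.
  rewrite sumr_const card_Sn -[X in _ * X]mulr_natl mulKf //.
  by rewrite pnatr_eq0 -lt0n fact_gt0.
apply: le_gauss_bound => // [|l l_ge0].
  by rewrite !mulr_ge0 // sumr_ge0 // => i _; exact: sqr_ge0.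
have cbar_ge0 : 0 <= cbar by rewrite mulr_ge0 ?sumr_ge0 ?invr_ge0.
have := symmetric_tail_le sym_sym cbar_ge0 sym_lip t l_ge0.
rewrite expect_sym => /le_trans; apply; rewrite ler_expR lerD2r.
rewrite ler_wpM2l ?sqr_ge0 // -mulrA.
have -> : 4 * (1 - n%:R / (slice_size kappa)%:R) * (\sum_(i < n) c i ^+ 2) / 4
  = (1 - n%:R / (slice_size kappa)%:R) * (\sum_(i < n) c i ^+ 2) by field; rewrite gt_eqF.
by rewrite ler_wpM2l // sqr_sum_le.
Qed.
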